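(* Let $Y$ be a real vector space, $F\subseteq Y$ and $a\in Y$. Suppose that $D\subset Y$ is a non-trivial algebraically closed convex pointed cone and $F\subseteq a+\operatorname{core}D$. Then $$\operatorname{WEff}(F,D)=\{y^0\in F\mid\exists k\in\operatorname{core}D:\ \|y^0-a\|_{D,k}=\min_{y\in F}\|y-a\|_{D,k}\}$$ and $$\operatorname{Eff}(F,D)=\{y^0\in F\mid\exists k\in\operatorname{core}D\ \forall y\in F\setminus\{y^0\}:\ \|y^0-a\|_{D,k}<\|y-a\|_{D,k}\}.$$ For $y^0\in\operatorname{WEff}(F,D)$, one can choose $k=y^0-a$, which results in $\|y^0-a\|_{D,k}=1$.
   Context: For $F,D\subseteq Y$, $\operatorname{Eff}(F,D):=\{y^0\in F\mid F\cap(y^0-D)\subseteq\{y^0\}\}$ and $\operatorname{WEff}(F,D):=\operatorname{Eff}(F,\operatorname{core}D)$. $\operatorname{core}D$ is the algebraic interior: $d\in\operatorname{core}D$ iff $d\in D$ and for each $v\in Y$ there is $\varepsilon>0$ with $d+sv\in D$ for all $s\in[0,\varepsilon]$. A set $D\subseteq Y$ is a cone iff $\lambda d\in D$ for all $\lambda\in[0,\infty)$, $d\in D$; non-trivial iff $D\ne\emptyset$, $D\ne\{0\}$, $D\ne Y$; pointed iff $D\cap(-D)=\{0\}$; algebraically closed iff for all $d\in D$, $y\in Y$: if $d+\lambda(y-d)\in D$ for all $\lambda\in(0,1)$, then $y\in D$. For such a cone $D$ and $k\in\operatorname{core}D$, $\|\cdot\|_{D,k}$ denotes the Minkowski functional of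 the order interval $[-k,k]_D=(D-k)\cap(k-D)$, i.e. $\|y\|_{D,k}=\inf\{\lambda>0\mid y\in\lambda[-k,k]_D\}$; it is a known fact that this is a norm on $Y$. *)

(* Defs.v *)
From mathcomp Require Import all_boot all_order all_algebra.
From mathcomp Require Import all_classical all_reals.
From mathcomp Require Import convex.

Set Implicit Arguments.
Unset Strict Implicit.
Unset Printing Implicit Defensive.

Import Order.TTheory GRing.Theory Num.Theory.

Local Open Scope classical_set_scope.
Local Open Scope ring_scope.

Definition core (R : realType) (Y : lmodType R) (D : set Y) : set Y :=
  [set d | D d /\
    forall v : Y, exists2 e : R, 0 < e &
      forall s : R, 0 <= s <= e -> D (d + s *: v)].

(** The first argument is the feasible set, the second the domination set. *)
Definition Eff (R : realType) (Y : lmodType R) (F D : set Y) : set Y :=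
  [set y0 | F y0 /\ F `&` [set y0 - d | d in D] `<=` [set y0]].

Definition WEff (R : realType) (Y : lmodType R) (F D : set Y) : set Y :=
  Eff F (core D).

(** A cone is closed under multiplication by [0] as well; the empty set is a
    cone in this sense. *)
Definition is_cone (R : realType) (Y : lmodType R) (D : set Y) : Prop :=
  forall (l : R) (d : Y), 0 <= l -> D d -> D (l *: d).

Definition nontrivial (R : realType) (Y : lmodType R) (D : set Y) : Prop :=
  [/\ D <> set0, D <> [set 0] & D <> setT].

Definition pointed (R : realType) (Y : lmodType R) (D : set Y) : Prop :=
  D `&` [set - d | d in D] = [set 0].

Definition algebraically_closed (R : realType) (Y : lmodType R) (D : set Y) :
    Prop :=
  forall d y : Y, D d ->
    (forall l : R, 0 < l < 1 -> D (d + l *: (y - d))) -> D y.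

Definition order_interval (R : realType) (Y : lmodType R) (D : set Y) (k : Y) :
    set Y :=
  [set d - k | d in D] `&` [set k - d | d in D].

(** [inf] is real-valued, with junk value [0] on the empty set; for [k] in the
    algebraic interior of a convex cone [D] the set below is nonempty. *)
Definition minkowski_norm (R : realType) (Y : lmodType R) (D : set Y) (k y : Y) :
    R :=
  inf [set l : R | 0 < l /\ [set l *: x | x in order_interval D k] y].

(** [m = min A], which includes the existence of the minimum. *)
Definition is_min (R : realType) (m : R) (A : set R) : Prop :=
  A m /\ lbound A m.

(* Main.v *)
Require Import Defs.
From mathcomp Require Import all_boot all_order all_algebra.
From mathcomp Require Import all_classical all_reals convex.
From mathcomp Require Import interval_inference lra.
Import Order.TTheory GRing.Theory Num.Theory.
Local Open Scope classical_set_scope.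
Local Open Scope ring_scope.

(** Fix [k] in the core of [D].  On [D] itself only one of the two order bounds
    in the definition of the norm can fail, so [minkowski_norm D k y] is there
    the infimum of the [l > 0] with [l *: k - y] in [D]
    ([mem_scaled_interval]).  Since [F] lies in [a + core D], all the vectors
    [y - a] that occur are in the core, and two complementary facts give the
    theorem.

    The norm is monotone for the order of [D] ([minkowski_norm_mono]), strictly
    so when the difference is in the core ([minkowski_norm_core_mono]).  Hence
    a point [y] of [F] dominating [y0] contradicts the strict minimality of
    the norm of [y0 - a], and a point dominating it through the core
    contradicts its minimality.

    Conversely take [k = y0 - a], which has norm [1].  The open unit ball around
    [0] meets [D] only in [k - core D] ([minkowski_norm_lt1]), and the closed
    one only in [k - D] ([minkowski_norm_le1]; here [D] must be algebraically
    closed).  So a competitor [y - a] of norm less than [1] gives [y0 - y] in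
    the core, which forces [y <> y0] ([core_neq0]) and contradicts weak
    efficiency.  A competitor with [y <> y0] of norm at most [1] gives [y0 - y]
    in [D] and contradicts efficiency. *)

Section OrderingCone.
Context {R : realType} {Y : lmodType R} {D : set Y}.
Hypothesis D_nontrivial : nontrivial D.
Hypothesis D_closed : algebraically_closed D.
Hypothesis D_convex : convex_set D.
Hypothesis D_cone : is_cone D.

Implicit Types (x y d k : Y) (l r e : R).

Lemma core_sub y : core D y -> D y.
Proof. by case. Qed.

Lemma cone_add x y : D x -> D y -> D (x + y).
Proof.
move=> Dx Dy.
(* For a cone, the sum is twice the midpoint. *)
have half_ge0 : 0 <= 2^-1 :> R by lra.
have half_le1 : 2^-1 <= 1 :> R by lra.
have : 2 *: (2^-1 *: x + (1 - 2^-1) *: y) = x + y.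
  rewrite scalerDr !scalerA mulrBr mulr1 divff ?pnatr_eq0// !scale1r.
  by rewrite (_ : 2 - 1 = 1 :> R) ?scale1r//; lra.
move=> <-; apply: D_cone; first by lra.
by have := D_convex x y (Itv01 half_ge0 half_le1)
     (mem_set Dx) (mem_set Dy) => /set_mem.
Qed.

Lemma core_add x y : core D x -> D y -> core D (x + y).
Proof.
move=> [Dx cx] Dy; split=> [|v]; first exact: cone_add.
have [e e0 De] := cx v; exists e => // s s0e.
by rewrite addrAC; apply: cone_add => //; apply: De.
Qed.

Lemma core_scale l x : 0 < l -> core D x -> core D (l *: x).
Proof.
move=> l0 [Dx cx]; split=> [|v]; first by apply: D_cone => //; exact: ltW.
have [e e0 De] := cx v; exists (l * e) => [|s /andP[s0 sle]].
  exact: mulr_gt0.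
rewrite (_ : l *: x + s *: v = l *: (x + (l^-1 * s) *: v)).
  apply: D_cone; first exact: ltW.
  apply: De; rewrite mulr_ge0 ?invr_ge0 ?(ltW l0)//=.
  by rewrite mulrC ler_pdivrMr// mulrC.
by rewrite scalerDr scalerA mulrA divff ?mul1r// gt_eqF.
Qed.

(** A cone with [0] in its core contains a positive multiple of every vector,
    hence is the whole space. *)
Lemma core_neq0 : ~ core D 0.
Proof.
case: D_nontrivial => _ _ DT [_ c0]; apply: DT; rewrite -subTset => v _.
have [e e0 De] := c0 v.
have /(De e) : 0 <= e <= e by rewrite ltW/=.
rewrite add0r => /(D_cone e^-1 _); rewrite scalerA mulVf ?gt_eqF// scale1r.
by apply; rewrite invr_ge0 ltW.
Qed.

(** If [l <= 0], then [- l *: k] lies in [D], and adding it to the core point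
    [l *: k] would put [0] in the core. *)
Lemma core_scale_gt0 k l : D k -> core D (l *: k) -> 0 < l.
Proof.
move=> Dk clk; rewrite ltNge; apply/negP => l0; apply: core_neq0.
rewrite -(subrr (l *: k)) -scaleNr; apply: core_add => //.
by apply: D_cone => //; rewrite oppr_ge0.
Qed.

(** The lower bound [- l *: k <= y] is automatic because both [k] and [y] are
    in [D]; only the upper bound [y <= l *: k] remains. *)
Lemma mem_scaled_interval k y l : D k -> D y -> 0 < l ->
  [set l *: x | x in order_interval D k] y <-> D (l *: k - y).
Proof.
move=> Dk Dy l0; have lN0 : l != 0 by rewrite gt_eqF.
split=> [[_ [_ [d Dd <-]]] <-|Dlky].
  by rewrite scalerBr subKr; apply: D_cone => //; exact: ltW.
exists (l^-1 *: y); last by rewrite scalerA divff// scale1r.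
have lV0 : 0 <= l^-1 by rewrite invr_ge0 ltW.
split.
  exists (l^-1 *: y + k); last by rewrite addrK.
  by apply: cone_add => //; exact: D_cone.
exists (l^-1 *: (l *: k - y)); first exact: D_cone.
by rewrite scalerBr scalerA mulVf// scale1r subKr.
Qed.

Lemma minkowski_norm_le k y l : D k -> D y -> 0 < l -> D (l *: k - y) ->
  minkowski_norm D k y <= l.
Proof.
move=> Dk Dy l0 Dlky; apply: ge_inf; first by exists 0 => ? [/ltW].
by split=> //; apply/mem_scaled_interval.
Qed.

(** That [k] is in the core ensures that some multiple of [k] dominates [y];
    otherwise the infimum would be that of the empty set.  Adding a multiple
    of [k] shows that the admissible scalars are upward closed. *)
Lemma minkowski_norm_lt k y r : core D k -> D y -> minkowski_norm D k y < r ->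
  0 < r /\ D (r *: k - y).
Proof.
move=> [Dk ck] Dy /inf_lt[|l [l0 /mem_scaled_interval-/(_ Dk Dy l0) Dl] lr].
  have [e e0 De] := ck (- y).
  exists e^-1; split; first by rewrite invr_gt0.
  apply/mem_scaled_interval => //; first by rewrite invr_gt0.
  rewrite (_ : _ - y = e^-1 *: (k + e *: - y)).
    apply: D_cone; first by rewrite invr_ge0 ltW.
    by apply: De; rewrite lexx ltW.
  by rewrite scalerDr scalerA mulVf ?gt_eqF// scale1r.
split; first exact: lt_trans lr.
rewrite (_ : r *: k - y = (l *: k - y) + (r - l) *: k).
  by apply: cone_add => //; apply: D_cone => //; rewrite subr_ge0 ltW.
by rewrite addrAC -scalerDl [l + _]addrC subrK.
Qed.

(** For [m < 1] strictly above the norm, [k - y] is the sum of the core point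
    [(1 - m) *: k] and the point [m *: k - y] of [D]. *)
Lemma minkowski_norm_lt1 k y : core D k -> D y -> minkowski_norm D k y < 1 ->
  core D (k - y).
Proof.
move=> ck Dy /midf_lt[nm m1].
have [_ Dm] := minkowski_norm_lt _ _ _ ck Dy nm.
set m := (_ / _) in m1 Dm.
rewrite (_ : k - y = (1 - m) *: k + (m *: k - y)).
  by apply: core_add => //; apply: core_scale => //; rewrite subr_gt0.
by rewrite addrA -scalerDl subrK scale1r.
Qed.

Lemma minkowski_norm_refl k : core D k -> minkowski_norm D k k = 1.
Proof.
move=> ck; have Dk := core_sub k ck.
apply/eqP; rewrite eq_le; apply/andP; split.
  apply: minkowski_norm_le => //; rewrite scale1r subrr.
  by rewrite -(scale0r k); exact: D_cone.
rewrite leNgt; apply/negP => /(minkowski_norm_lt1 _ _ ck Dk).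
by rewrite subrr; exact: core_neq0.
Qed.

Lemma minkowski_norm_mono k x y : core D k -> D x -> D y -> D (y - x) ->
  minkowski_norm D k x <= minkowski_norm D k y.
Proof.
move=> ck Dx Dy Dyx; apply/ler_addgt0Pr => e e0.
have [r0 Dr] : 0 < minkowski_norm D k y + e /\
    D ((minkowski_norm D k y + e) *: k - y).
  by apply: minkowski_norm_lt; rewrite // ltrDl.
apply: minkowski_norm_le => //; first exact: core_sub.
by rewrite -(subrKA y); exact: cone_add.
Qed.

(** A small multiple [e *: k] can be subtracted from the core point [y - x]
    without leaving [D], so every scalar admissible for [y] can be lowered by
    [e] and stays admissible for [x].  This lowers the infimum by at least
    [e], but the lowered scalar must be positive, which is where [core D x]
    enters. *)
Lemma minkowski_norm_core_mono k x y : core D k -> core D x -> D y ->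
  core D (y - x) -> minkowski_norm D k x < minkowski_norm D k y.
Proof.
move=> ck cx Dy [_ cyx].
have [e e0 De] := cyx (- k).
set n := minkowski_norm D k y.
(* Starting [e / 2] above the infimum and lowering by [e] ends strictly below. *)
have [r0 Dr] : 0 < n + e / 2 /\ D ((n + e / 2) *: k - y).
  by apply: minkowski_norm_lt; rewrite // ltrDl divr_gt0.
have De' : D (y - x + e *: - k) by apply: De; rewrite lexx ltW.
have /(cone_add _ _ Dr) := De'.
have -> : ((n + e / 2) *: k - y) + (y - x + e *: - k) = (n - e / 2) *: k - x.
  rewrite -[y - x + _]addrA subrKA [- x + _]addrC addrA scalerN -scalerBl.
  by congr (_ *: _ - _); lra.
move=> Dn.
have n'0 : 0 < n - e / 2.
  apply: (core_scale_gt0 k); first exact: core_sub.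
  by rewrite -(subrKC x (_ *: k)); exact: core_add.
apply: (@le_lt_trans _ _ (n - e / 2)); last by lra.
apply: minkowski_norm_le => //; first exact: core_sub.
exact: core_sub.
Qed.

(** Every [r > 1] is admissible, so the half-open segment from [2 *: k - y] to
    [k - y] is in [D], and algebraic closedness adds its end point. *)
Lemma minkowski_norm_le1 k y : core D k -> D y -> minkowski_norm D k y <= 1 ->
  D (k - y).
Proof.
move=> ck Dy n1.
have Dgt1 r : 1 < r -> D (r *: k - y).
  by move=> r1; case: (minkowski_norm_lt k y r ck Dy (le_lt_trans n1 r1)).
apply: (D_closed (2 *: k - y)) => [|l /andP[l0 l1]]; first by apply: Dgt1; lra.
rewrite (_ : _ + _ = (2 - l) *: k - y).
  by apply: Dgt1; lra.
rewrite (_ : k - y - (2 *: k - y) = - k).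
  by rewrite scalerN addrAC -scalerBl; congr (_ *: _ - _); lra.
by rewrite opprB addrA subrK scaler_nat mulr2n opprD addNKr.
Qed.

End OrderingCone.

Theorem theorem11 (R : realType) (Y : lmodType R) (F : set Y) (a : Y)
    (D : set Y)
    (D_nontrivial : nontrivial D)
    (D_closed : algebraically_closed D)
    (D_convex : convex_set D)
    (D_pointed : pointed D)
    (D_cone : is_cone D)
    (F_sub : F `<=` [set a + d | d in core D]) :
  [/\ WEff F D =
        [set y0 | F y0 /\ exists2 k : Y, core D k &
           is_min (minkowski_norm D k (y0 - a))
                  [set minkowski_norm D k (y - a) | y in F]],
      Eff F D =
        [set y0 | F y0 /\ exists2 k : Y, core D k &
           forall y : Y, (F `\ y0) y ->
             minkowski_norm D k (y0 - a) < minkowski_norm D k (y - a)] &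
      forall y0 : Y, WEff F D y0 ->
        [/\ core D (y0 - a),
            is_min (minkowski_norm D (y0 - a) (y0 - a))
                   [set minkowski_norm D (y0 - a) (y - a) | y in F] &
            minkowski_norm D (y0 - a) (y0 - a) = 1]].
Proof.
have Fcore y : F y -> core D (y - a).
  by move=> /F_sub[d cd <-]; rewrite addrAC subrr add0r.
have FD y : F y -> D (y - a) by move=> /Fcore; exact: core_sub.
have subBB x y : (x - a) - (y - a) = x - y by rewrite opprB addrA subrK.
have WEff_min y0 : WEff F D y0 ->
    [/\ core D (y0 - a),
        is_min (minkowski_norm D (y0 - a) (y0 - a))
               [set minkowski_norm D (y0 - a) (y - a) | y in F] &
        minkowski_norm D (y0 - a) (y0 - a) = 1].
  move=> [Fy0 Wy0]; have cy0 := Fcore _ Fy0.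
  have n1 : minkowski_norm D (y0 - a) (y0 - a) = 1 by exact: minkowski_norm_refl.
  split=> //; split; first by exists y0.
  move=> _ [y Fy <-]; rewrite n1 leNgt; apply/negP => nlt1.
  have cyy0 : core D (y0 - y).
    rewrite -subBB; apply: minkowski_norm_lt1 => //; exact: FD.
  have yE : y = y0.
    by apply: Wy0; split=> //; exists (y0 - y) => //; rewrite subKr.
  by apply: (core_neq0 D_nontrivial D_cone); rewrite -(subrr y0) -{2}yE.
split=> //.
- apply/seteqP; split=> [y0 Wy0|y0 [Fy0 [k ck [_ kmin]]]].
    have [cy0 ymin _] := WEff_min y0 Wy0.
    by split; [case: Wy0|exists (y0 - a)].
  split=> // y [Fy [d cd yE]].
  have : minkowski_norm D k (y0 - a) <= minkowski_norm D k (y - a).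
    by apply: kmin; exists y.
  rewrite leNgt => /negP[]; apply: minkowski_norm_core_mono => //.
  - exact: Fcore.
  - exact: FD.
  - by rewrite subBB -yE subKr.
- apply/seteqP; split=> [y0 [Fy0 Ey0]|y0 [Fy0 [k ck kmin]]].
    have cy0 := Fcore _ Fy0.
    split=> //; exists (y0 - a) => // y [Fy yNy0].
    rewrite (minkowski_norm_refl _ _ _ _ cy0)// ltNge; apply/negP => n1.
    apply: yNy0; apply: Ey0; split=> //; exists (y0 - y); last exact: subKr.
    by rewrite -subBB; apply: minkowski_norm_le1 => //; exact: FD.
  split=> // y [Fy [d Dd yE]]; apply: contrapT => yNy0.
  have := kmin y (conj Fy yNy0); rewrite ltNge => /negP[].
  apply: minkowski_norm_mono => //; [exact: FD|exact: FD|].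
  by rewrite subBB -yE subKr.
Qed.
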